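(* Let $m \ge 4$ and $n \ge 3$ be integers and let $d$ be a positive integer. Then there exists a matrix $A \in \mathbb{R}^{[m]\times[n]}$ such that (i) $A$ does not have an elimination ordering, and (ii) for every vector $b \in \mathbb{R}^{[m]}$, the solution graph $G(R(A,b))$ is connected.
   Context: Fix a positive integer $d$ and let $D=\{0,1,\dots,d\}$; $[n]=\{1,\dots,n\}$. For $A\in\mathbb{R}^{[m]\times[n]}$ and $b\in\mathbb{R}^{[m]}$, $R(A,b)=\{x\in D^{[n]} : Ax\ge b\}$ is the set of feasible solutions of the integer linear system $(A,b)$. For $R\subseteq D^{[n]}$, the solution graph $G(R)$ is the undirected graph with vertex set $R$ in which $x,y$ are adjacent iff they differ in exactly one coordinate (Hamming distance $1$). A matrix $A=(a_{ij})$ with column index set $J$ can be eliminated at column $j\in J$ if (i) for every row $i$ with $a_{ij}>0$ we have $a_{ij'}=0$ for all $j'\in J\setminus\{j\}$, or (ii) for every row $i$ with $a_{ij}<0$ we have $a_{ij'}=0$ for all $j'\in J\setminus\{j\}$. For $J'\subseteq [n]$, $\mathrm{elm}(A,J')$ denotes the submatrix of $A$ obtained by deleting the columns indexed by $J'$. A sequence $(j_1,\dots,j_n)$ of the elements of $[n]$ is an elimination ordering (EO) of $A\in\mathbb{R}^{[m]\times[n]}$ if for every $t\in[n]$ the matrix $\mathrm{elm}(A,\{j_1,\dots,j_{t-1}\})$ can be eliminated at column $j_t$. *)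

(* Defs.v *)
From HB Require Import structures.
From mathcomp Require Import all_boot all_order all_algebra.
From mathcomp Require Import Rstruct.
From Stdlib Require Import Reals.
Set Implicit Arguments. Unset Strict Implicit. Unset Printing Implicit Defensive.
Import Order.TTheory GRing.Theory Num.Theory.
Local Open Scope ring_scope.

(* Points of D^[n] with D = {0,...,d}: finite functions 'I_n -> 'I_d.+1. *)
Definition point (d n : nat) := {ffun 'I_n -> 'I_d.+1}.

Definition feasible (d m n : nat) (A : 'M[R]_(m, n)) (b : 'cV[R]_m)
    (x : point d n) : bool :=
  [forall i : 'I_m, b i ord0 <= \sum_(j < n) A i j * (nat_of_ord (x j))%:R].

Definition hamming1 (d n : nat) (x y : point d n) : bool :=
  #|[set j : 'I_n | x j != y j]| == 1%N.

Definition sol_edge (d m n : nat) (A : 'M[R]_(m, n)) (b : 'cV[R]_m) :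
    rel (point d n) :=
  fun x y => [&& feasible A b x, feasible A b y & hamming1 x y].

Definition sol_graph_connected (d m n : nat) (A : 'M[R]_(m, n))
    (b : 'cV[R]_m) : Prop :=
  forall x y : point d n, feasible A b x -> feasible A b y ->
    connect (sol_edge A b) x y.

Definition can_elim (m n : nat) (A : 'M[R]_(m, n)) (J : {set 'I_n})
    (j : 'I_n) : bool :=
  (j \in J) &&
  ([forall i : 'I_m, (0 < A i j) ==> [forall j' in J :\ j, A i j' == 0]]
   || [forall i : 'I_m, (A i j < 0) ==> [forall j' in J :\ j, A i j' == 0]]).

Fixpoint elim_seq (m n : nat) (A : 'M[R]_(m, n)) (J : {set 'I_n})
    (s : seq 'I_n) : Prop :=
  match s with
  | [::] => True
  | j :: s' => can_elim A J j /\ elim_seq A (J :\ j) s'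
  end.

Definition is_EO (m n : nat) (A : 'M[R]_(m, n)) (s : seq 'I_n) : Prop :=
  perm_eq s (enum 'I_n) /\ elim_seq A [set: 'I_n] s.

Definition has_EO (m n : nat) (A : 'M[R]_(m, n)) : Prop :=
  exists s : seq 'I_n, is_EO A s.

(* Main.v *)
Require Import Defs.
From mathcomp Require Import all_boot all_order all_algebra.
From mathcomp Require Import Rstruct.
From Stdlib Require Import Reals.
From mathcomp Require Import lra.
Set Implicit Arguments. Unset Strict Implicit. Unset Printing Implicit Defensive.
Import Order.TTheory GRing.Theory Num.Theory.
Local Open Scope ring_scope.

(* The witness has the four constraints x0 + x1 >= b0, x0 - x1 >= b1,
   x2 - x0 >= b2 and -x0 - x2 >= b3 (all other entries zero).  Each of the
   columns 0, 1, 2 meets a positive and a negative entry in rows that also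
   involve another of these columns, so none of them can ever be eliminated
   first.  The system says max(b0 - x1, b1 + x1) <= x0 <= min(x2 - b2, -x2 - b3);
   moving x1 to a minimiser of the lower bound and x2 to a maximiser of the
   upper bound only enlarges the admissible range of x0, and the feasible
   points on a coordinate line form an interval.  Hence every feasible point
   is joined to one common point. *)

Definition upd d n (x : point d n) (j : 'I_n) (v : 'I_d.+1) : point d n :=
  [ffun k => if k == j then v else x k].

Lemma updE d n (x : point d n) j v k : upd x j v k = if k == j then v else x k.
Proof. exact: ffunE. Qed.

Section Update.
Variables (d n : nat) (x : point d n) (j : 'I_n).

Lemma upd_same v : upd x j v j = v.
Proof. by rewrite updE eqxx. Qed.

Lemma upd_other v k : k != j -> upd x j v k = x k.
Proof. by rewrite updE => /negbTE->. Qed.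

Lemma upd_id : upd x j (x j) = x.
Proof. by apply/ffunP => k; rewrite updE; case: eqP => [->|]. Qed.

Lemma upd_upd v w : upd (upd x j v) j w = upd x j w.
Proof. by apply/ffunP => k; rewrite !updE; case: eqP. Qed.

Lemma hamming1_upd v : x j != v -> hamming1 x (upd x j v).
Proof.
move=> xjv; rewrite /hamming1 (_ : [set k | _] = [set j]) ?cards1 //.
apply/setP => k; rewrite !inE updE.
by case: (k =P j) => [->|]; rewrite ?xjv ?eqxx.
Qed.

End Update.

Lemma hamming1C d n (x y : point d n) : hamming1 x y = hamming1 y x.
Proof.
rewrite /hamming1 (_ : [set k | x k != y k] = [set k | y k != x k]) //.
by apply/setP => k; rewrite !inE eq_sym.
Qed.

Section Elimination.
Variables (m n : nat) (A : 'M[R]_(m, n)).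

Lemma not_can_elim_mixed J j ip jp ineg jn :
  0 < A ip j -> jp \in J :\ j -> A ip jp != 0 ->
  A ineg j < 0 -> jn \in J :\ j -> A ineg jn != 0 -> ~~ can_elim A J j.
Proof.
move=> Apos Jjp Ajp Aneg Jjn Ajn; rewrite /can_elim negb_and negb_or orbC.
apply/orP; left; apply/andP; split; apply/forallPn.
- by exists ip; rewrite negb_imply Apos; apply/forallPn; exists jp; rewrite Jjp.
- by exists ineg; rewrite negb_imply Aneg; apply/forallPn; exists jn; rewrite Jjn.
Qed.

Definition elim_blocking (S : {set 'I_n}) : Prop :=
  forall (J : {set 'I_n}) j, S \subset J -> j \in S -> ~~ can_elim A J j.

Lemma elim_seq_blocked S s (J : {set 'I_n}) :
  elim_blocking S -> S \subset J -> elim_seq A J s -> {in s, forall j, j \notin S}.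
Proof.
move=> blockS; elim: s J => [|j s IHs] J SJ //= [elim_j elim_s].
have Sj : j \notin S by apply: contraL elim_j => /(blockS _ _ SJ).
have SJj : S \subset J :\ j.
  apply/subsetP => i Si; rewrite !inE (subsetP SJ) // andbT.
  by apply: contraNneq Sj => <-.
by move=> i; rewrite inE => /predU1P[->|si] //; apply: (IHs _ SJj elim_s).
Qed.

Lemma elim_blocking_no_EO (S : {set 'I_n}) j : j \in S -> elim_blocking S -> ~ has_EO A.
Proof.
move=> Sj blockS [s [perm_s elim_s]].
have /elim_seq_blocked : j \in s by rewrite (perm_mem perm_s) mem_enum.
by move=> /(_ S _ blockS (subsetT S) elim_s); rewrite Sj.
Qed.

End Elimination.

Section SolutionGraph.
Variables (d m n : nat) (A : 'M[R]_(m, n)) (b : 'cV[R]_m).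
Local Notation edge := (@sol_edge d m n A b).

Lemma sol_edgeC : symmetric edge.
Proof. by move=> x y; rewrite /sol_edge hamming1C andbCA. Qed.

Lemma row_sum_upd i (x : point d n) j v :
  \sum_(k < n) A i k * (nat_of_ord (upd x j v k))%:R =
  \sum_(k < n | k != j) A i k * (nat_of_ord (x k))%:R + A i j * (nat_of_ord v)%:R.
Proof.
rewrite (bigD1 j) //= upd_same addrC; congr (_ + _).
by apply: eq_bigr => k kj; rewrite upd_other.
Qed.

Lemma feasible_upd_between (x : point d n) j (u t v : 'I_d.+1) :
  (u <= t <= v)%nat -> feasible A b (upd x j u) -> feasible A b (upd x j v) ->
  feasible A b (upd x j t).
Proof.
move=> /andP[ut tv] /forallP fu /forallP fv; apply/forallP => i.
move: (fu i) (fv i); rewrite !row_sum_upd => le_u le_v.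
have [Aij_ge0|Aij_lt0] := lerP 0 (A i j).
- by apply: (le_trans le_u); rewrite lerD2l ler_wpM2l ?ler_nat.
- by apply: (le_trans le_v); rewrite lerD2l ler_wnM2l ?ler_nat ?ltW.
Qed.

Lemma connect_upd_ge (x : point d n) j (v : 'I_d.+1) :
  (x j <= v)%nat -> feasible A b x -> feasible A b (upd x j v) ->
  connect edge x (upd x j v).
Proof.
move: {2}(v - x j)%nat (erefl (v - x j)%nat) => gap.
elim: gap x => [|gap IHgap] x gap_eq xj_le_v fx fv.
  suff -> : v = x j by rewrite upd_id.
  by apply: val_inj; apply/eqP; rewrite eqn_leq xj_le_v -subn_eq0 gap_eq.
have xj_lt_v : (x j < v)%nat by rewrite -subn_gt0 gap_eq.
have t_lt : ((x j).+1 < d.+1)%nat := leq_trans xj_lt_v (ltn_ord v).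
pose t : 'I_d.+1 := Ordinal t_lt.
have ft : feasible A b (upd x j t).
  by apply: (feasible_upd_between (u := x j) (v := v)); rewrite ?upd_id //= leqnSn.
apply: (connect_trans (y := upd x j t)).
  have xj_neq_t : x j != t by rewrite -val_eqE /= neq_ltn ltnSn.
  by apply: connect1; rewrite /sol_edge fx ft hamming1_upd.
rewrite -(upd_upd x j t v); apply: IHgap; rewrite ?upd_same ?upd_upd //.
by rewrite subnS gap_eq.
Qed.

Lemma connect_upd (x : point d n) j v :
  feasible A b x -> feasible A b (upd x j v) -> connect edge x (upd x j v).
Proof.
move=> fx fv; have [xj_le_v|v_lt_xj] := leqP (x j) v; first exact: connect_upd_ge.
rewrite (sym_connect_sym sol_edgeC).
have := @connect_upd_ge (upd x j v) j (x j).
by rewrite upd_upd upd_id upd_same; apply=> //; apply: ltnW.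
Qed.

Lemma connect_mixtures (x z : point d n) :
  (forall w : point d n, (forall j, w j = x j \/ w j = z j) -> feasible A b w) ->
  connect edge x z.
Proof.
move: {2}#|[set j | x j != z j]| (erefl #|[set j | x j != z j]|) => k.
elim: k x => [|k IHk] x diff_x feasible_mix.
  suff -> : x = z by [].
  apply/ffunP => j; apply/eqP; apply: contraT => xzj.
  have : j \in [set j | x j != z j] by rewrite inE.
  by rewrite (cards0_eq diff_x) inE.
have [j] : exists j, j \in [set j | x j != z j].
  by apply/card_gt0P; rewrite diff_x.
rewrite inE => xzj; set y := upd x j (z j).
have y_mix w : (forall i, w i = y i \/ w i = z i) -> forall i, w i = x i \/ w i = z i.
  move=> wy i; case: (wy i) => ->; last by right.
  by rewrite /y updE; case: (i =P j) => [->|_]; [right | left].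
have fx : feasible A b x by apply: feasible_mix; left.
have fy : feasible A b y by apply: feasible_mix; apply: y_mix; left.
apply: connect_trans (connect1 _) (IHk y _ _); last by move=> w /y_mix /feasible_mix.
  by rewrite /sol_edge fx fy hamming1_upd.
have : [set i | y i != z i] = [set i | x i != z i] :\ j.
  by apply/setP => i; rewrite !inE /y updE; case: (i =P j) => [->|]; rewrite ?eqxx.
move=> ->; have := cardsD1 j [set i | x i != z i].
by rewrite diff_x inE xzj => -[].
Qed.

End SolutionGraph.

Definition counter_entry (i j : nat) : R :=
  match j, i with
  | 0, 0 | 0, 1 | 1, 0 | 2, 2 => 1
  | 0, 2 | 0, 3 | 1, 1 | 2, 3 => -1
  | _, _ => 0
  end.

Definition counter_mx m n : 'M[R]_(m, n) := \matrix_(i, j) counter_entry i j.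

Section CounterMatrix.
Variables (l k : nat).
Local Notation A := (counter_mx l.+4 k.+3).
Local Notation r i := (@Ordinal l.+4 i isT).
Local Notation c0 := (@Ordinal k.+3 0 isT).
Local Notation c1 := (@Ordinal k.+3 1 isT).
Local Notation c2 := (@Ordinal k.+3 2 isT).

Lemma counter_elim_blocking : elim_blocking A [set c0; c1; c2].
Proof.
move=> J j SJ; have inJ i : i \in [set c0; c1; c2] -> i \in J := subsetP SJ i.
have J0 : c0 \in J by apply: inJ; rewrite !inE eqxx.
have J1 : c1 \in J by apply: inJ; rewrite !inE eqxx orbT.
have J2 : c2 \in J by apply: inJ; rewrite !inE eqxx !orbT.
rewrite !inE => /orP[/orP[]|] /eqP->.
- apply: (not_can_elim_mixed (ip := r 0) (jp := c1) (ineg := r 2) (jn := c2));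
    by rewrite ?inE ?mxE /= ?ltr01 ?oppr_lt0 ?oppr_eq0 ?oner_eq0.
- apply: (not_can_elim_mixed (ip := r 0) (jp := c0) (ineg := r 1) (jn := c0));
    by rewrite ?inE ?mxE /= ?ltr01 ?oppr_lt0 ?oppr_eq0 ?oner_eq0.
- apply: (not_can_elim_mixed (ip := r 2) (jp := c0) (ineg := r 3) (jn := c0));
    by rewrite ?inE ?mxE /= ?ltr01 ?oppr_lt0 ?oppr_eq0 ?oner_eq0.
Qed.

Section Connectivity.
Variables (d : nat) (b : 'cV[R]_l.+4).
Local Notation edge := (@sol_edge d _ _ A b).
Local Notation bb i := (b (r i) ord0).
Local Notation xR x j := ((nat_of_ord (x j))%:R : R).

Definition lower_bound (t : R) : R := Num.max (bb 0 - t) (bb 1 + t).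
Definition upper_bound (t : R) : R := Num.min (t - bb 2) (- t - bb 3).
Definition zero_rows_ok : bool :=
  [forall i : 'I_l.+4, (3 < i)%nat ==> (b i ord0 <= 0)].

Lemma counter_row_sum (x : point d k.+3) (i : 'I_l.+4) :
  \sum_(j < k.+3) A i j * xR x j =
  counter_entry i 0 * xR x c0 + counter_entry i 1 * xR x c1 +
  counter_entry i 2 * xR x c2.
Proof.
rewrite 3!big_ord_recl big1 ?addr0 => [|j _]; last by rewrite mxE mul0r.
by rewrite !mxE !addrA; congr (_ * xR x _ + _ * xR x _ + _ * xR x _); apply: val_inj.
Qed.

Lemma feasible_counterE (x : point d k.+3) :
  feasible A b x =
  (lower_bound (xR x c1) <= xR x c0 <= upper_bound (xR x c2)) && zero_rows_ok.
Proof.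
rewrite ge_max le_min; apply/forallP/andP => [feas|[bounds rest] i].
  move: (feas (r 0)) (feas (r 1)) (feas (r 2)) (feas (r 3)).
  rewrite !counter_row_sum /= !(mul1r, mulN1r, mul0r, addr0) => r0 r1 r2 r3.
  split; first by apply/andP; split; apply/andP; split; lra.
  apply/forallP => -[[|[|[|[|i]]]] lt] //=; move: (feas (Ordinal lt)).
  by rewrite counter_row_sum /= !mul0r !addr0; apply.
move: bounds => /andP[/andP[lo0 lo1] /andP[up2 up3]].
rewrite counter_row_sum; case: i => -[|[|[|[|i]]]] lt /=;
  rewrite ?(bool_irrelevance lt isT) !(mul1r, mulN1r, mul0r, addr0); try lra.
by move/forallP: rest => /(_ (Ordinal lt)).
Qed.

Lemma feasible_counter_core (x y : point d k.+3) :
  x c0 = y c0 -> x c1 = y c1 -> x c2 = y c2 -> feasible A b x = feasible A b y.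
Proof. by move=> e0 e1 e2; rewrite !feasible_counterE e0 e1 e2. Qed.

Definition x1_opt : 'I_d.+1 := [arg min_(a < ord0) lower_bound a%:R]%O.
Definition x2_opt : 'I_d.+1 := [arg max_(a > ord0) upper_bound a%:R]%O.

Lemma lower_bound_x1_opt (a : 'I_d.+1) : lower_bound x1_opt%:R <= lower_bound a%:R.
Proof. by rewrite /x1_opt; case: arg_minP => // a1 _; apply. Qed.

Lemma upper_bound_x2_opt (a : 'I_d.+1) : upper_bound a%:R <= upper_bound x2_opt%:R.
Proof. by rewrite /x2_opt; case: arg_maxP => // a2 _; apply. Qed.

Lemma counter_connect_hub (q x : point d k.+3) :
  feasible A b q -> feasible A b x ->
  connect edge x (upd (upd q c1 x1_opt) c2 x2_opt).
Proof.
move=> fq fx; move: (fq) (fx).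
rewrite !feasible_counterE => /andP[/andP[lo_q up_q] _] /andP[/andP[lo_x up_x] rest].
have feasibleI (w : point d k.+3) :
    lower_bound (xR w c1) <= xR w c0 -> xR w c0 <= upper_bound (xR w c2) ->
    feasible A b w.
  by move=> lo up; rewrite feasible_counterE lo up rest.
have lo1 := lower_bound_x1_opt; have up2 := upper_bound_x2_opt.
set x1 := upd x c1 x1_opt; set x2 := upd x1 c2 x2_opt; set x3 := upd x2 c0 (q c0).
set z := upd (upd q c1 x1_opt) c2 x2_opt.
have f1 : feasible A b x1.
  by apply: feasibleI; rewrite !updE //=; apply: le_trans (lo1 _) lo_x.
have f2 : feasible A b x2.
  apply: feasibleI; rewrite !updE /=; first exact: le_trans (lo1 _) lo_x.
  exact: le_trans up_x (up2 _).
have f3 : feasible A b x3.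
  apply: feasibleI; rewrite !updE /=; first exact: le_trans (lo1 _) lo_q.
  exact: le_trans up_q (up2 _).
apply: connect_trans (connect_upd fx f1) _.
apply: connect_trans (connect_upd f1 f2) _.
apply: connect_trans (connect_upd f2 f3) _.
apply: connect_mixtures => w mix.
have agree i : z i = x3 i -> w i = x3 i by case: (mix i) => -> .
by rewrite (feasible_counter_core (y := x3)) ?agree ?updE.
Qed.

Lemma counter_connected : sol_graph_connected d A b.
Proof.
move=> x y fx fy; apply: connect_trans (counter_connect_hub fy fx) _.
by rewrite (sym_connect_sym (@sol_edgeC _ _ _ A b)); apply: counter_connect_hub.
Qed.

End Connectivity.
End CounterMatrix.

(* [Reals] rebinds the key [%N], so with ring_scope open the frozen
   [(4 <= m)%N] would be read as the ring order. *)
Local Close Scope ring_scope.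

Theorem theorem1 (m n d : nat) (hm : (4 <= m)%N) (hn : (3 <= n)%N)
    (hd : (0 < d)%N) :
  exists A : 'M[R]_(m, n),
    ~ has_EO A /\
    forall b : 'cV[R]_m, sol_graph_connected d A b.
Proof.
case: m hm => [|[|[|[|l]]]] // _; case: n hn => [|[|[|k]]] // _.
(* [hd] is unused: the construction works for d = 0 as well. *)
exists (counter_mx l.+4 k.+3); split; last exact: counter_connected.
apply: (elim_blocking_no_EO (j := @Ordinal k.+3 0 isT) _ (@counter_elim_blocking l k)).
by rewrite !inE eqxx.
Qed.
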